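(* For every positive integer $h$ there exists a $\mathrm{GDD}(4,5,5\cdot 4h+8h)$ of type $(4h)^{5}(8h)^1$.
   Context: A group divisible design $\mathrm{GDD}(t,k,m)$ of type $g_1^{n_1} g_2^{n_2}\cdots g_r^{n_r}$, where $t \ge 2$ and $m=\sum_{i=1}^r n_i g_i$, is a triple $(X,G,B)$ such that $X$ is a set of $m$ points; $G$ is a partition of $X$ into $n=\sum_{i=1}^r n_i$ groups, of which $n_i$ have exactly $g_i$ points, $1\le i\le r$; $B$ is a set of $k$-subsets of $X$ (blocks); each block contains at most one point from each group; and each $t$-subset of $X$ which contains at most one point from each group is contained in exactly one block of $B$. *)

(* Defs.v *)
From mathcomp Require Import all_boot.
Set Implicit Arguments.
Unset Strict Implicit.
Unset Printing Implicit Defensive.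

(* A type g_1^{n_1} ... g_r^{n_r} is the list [:: (g_1, n_1); ...; (g_r, n_r)],
   group size first, multiplicity second. *)
Definition group_type := seq (nat * nat).

Definition group_type_order (ty : group_type) : nat :=
  \sum_(gn <- ty) gn.2 * gn.1.

Definition group_type_sizes (ty : group_type) : seq nat :=
  flatten [seq nseq gn.2 gn.1 | gn <- ty].

Definition transverse (X : finType) (G : {set {set X}}) (A : {set X}) : Prop :=
  forall g, g \in G -> #|A :&: g| <= 1.

Record is_GDD (t k m : nat) (ty : group_type)
    (X : finType) (G B : {set {set X}}) : Prop := IsGDD {
  GDD_strength : 2 <= t;
  GDD_order : m = group_type_order ty;
  GDD_points : #|X| = m;
  GDD_groups : partition G [set: X];
  (* Equality of multisets of group sizes: this also fixes the number of groups,
     and a size listed twice in ty has its multiplicities added. *)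
  GDD_group_sizes :
    perm_eq [seq #|g : {set X}| | g <- enum G] (group_type_sizes ty);
  GDD_block_size : forall b, b \in B -> #|b| = k;
  GDD_block_transverse : forall b, b \in B -> transverse G b;
  GDD_cover : forall T : {set X}, #|T| = t -> transverse G T ->
    exists! b : {set X}, b \in B /\ T \subset b
}.

(* Main.v *)
Require Import Defs.
From mathcomp Require Import all_boot all_algebra.

Set Implicit Arguments.
Unset Strict Implicit.
Unset Printing Implicit Defensive.

Import GRing.Theory.

(** A GDD(4,5,28) of type 4^5 8^1 is built by hand, and every point is then
    given weight [h] by attaching to it a residue modulo [h]: a set of labelled
    points is a block when it projects bijectively onto a block and its labels
    sum to zero.  Given a labelled transverse 4-set, the fifth point is forced
    by the small design and its label by the sum condition
    ([inflate_extendable]).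

    In the small design every point is a graph on the vertices 0, ..., 4 of K_5
    in which all degrees are even.  The five groups of size 4 are indexed by the
    vertices: group [k] consists of the empty graph and the three 4-cycles on the
    vertices other than [k].  The group of size 8 is the F_2-span, under
    symmetric difference, of the pentagons 01234, 01342 and 01423.  Two facts
    make this work.  In group [k], the star of a vertex [i != k] (the set of its
    neighbours) takes each even subset of the three vertices other than [i] and
    [k] exactly once; in the large group, the star of [i] takes each even subset
    of the four vertices other than [i] exactly once.  The second fact says that
    no nonempty graph of the span has an isolated vertex, which is what the
    choice of the pentagons achieves ([exists_unique_star]).

    Fix the rotational tournament on the five vertices, where each vertex beats
    two others.  A transverse 5-set meeting the large group misses exactly one
    small group [i]; it is a block when the star of [i] in the sum of its graphs
    is the set of vertices beaten by [i].

    Let [T] be a transverse 4-set, and call deficit of [T] at [i] the sum of the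
    star of [i] in the graphs of [T] and of the set beaten by [i]: an even set.
    A point completing [T] to a block that misses group [i] must have star at [i]
    equal to this deficit.  If [T] misses group [i] and the large group, exactly
    one graph of the large group does.  If [T] misses groups [i] and [j], the
    deficit at [i] contains [j] if and only if the deficit at [j] does not
    contain [i], since graphs are symmetric and the tournament is antisymmetric.
    A graph of group [j] has no edge at [j], so [T] can be completed from group
    [j] only when the deficit at [i] omits [j], and then by exactly one graph;
    thus exactly one of the two groups completes [T], in one way
    ([base_extendable]). *)

(** * Group divisible designs described by a class map *)

(** For blocks of size [t + 1], covering each transverse [t]-set once amounts to
    saying that it extends to a block by exactly one point.  The groups are the
    fibers of [c], so that transverse means that [c] is injective. *)
Definition one_point_extendable (t : nat) (X I : finType) (c : X -> I)
    (B : {set {set X}}) : Prop :=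
  (forall b, b \in B -> #|b| = t.+1 /\ {in b &, injective c}) /\
  (forall T : {set X}, #|T| = t -> {in T &, injective c} ->
     exists! p, p |: T \in B).

Definition fiber (X I : finType) (c : X -> I) (a : I) : {set X} :=
  [set x | c x == a].

Lemma sumn_group_type_sizes ty :
  sumn (group_type_sizes ty) = group_type_order ty.
Proof.
rewrite /group_type_order /group_type_sizes; elim: ty => [|gn ty IH].
  by rewrite big_nil.
by rewrite /= sumn_cat sumn_nseq IH big_cons mulnC.
Qed.

Lemma card_fibers (X I : finType) (c : X -> I) :
  #|X| = \sum_a #|fiber c a|.
Proof.
rewrite -sum1_card (partition_big c xpredT) //=; apply: eq_bigr => a _.
by rewrite -sum1_card; apply: eq_bigl => x; rewrite inE.
Qed.

(** Surjectivity of [c] rules out empty fibers, which would break both the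
    partition and the count of the groups. *)
Lemma GDD_of_classes (t : nat) (X I : finType) (c : X -> I) B ty :
  1 < t -> (forall a, exists x, c x = a) ->
  perm_eq [seq #|fiber c a| | a <- enum I] (group_type_sizes ty) ->
  one_point_extendable t c B ->
  is_GDD t t.+1 (group_type_order ty) ty [set fiber c a | a : I] B.
Proof.
move=> t_gt1 c_surj sizes [Bblock Bext].
have fiber_inj : injective (fiber c).
  move=> a a' /setP eq_aa'; have [x cx] := c_surj a.
  by have := eq_aa' x; rewrite !inE cx eqxx => /esym/eqP.
have transverseP A : transverse [set fiber c a | a : I] A
    <-> {in A &, injective c}.
  split=> [trA x y Ax Ay eq_c | injA _ /imsetP[a _ ->]].
    have /card_le1P := trA _ (imset_f (fiber c) (isT : c x \in I)).
    move=> /(_ x); rewrite !inE Ax eqxx /= => /(_ isT y).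
    by rewrite !inE Ay eq_c eqxx => /esym/eqP.
  apply/card_le1_eqP => x y; rewrite !inE => /andP[Ax /eqP cx] /andP[Ay /eqP cy].
  by apply: injA => //; rewrite cx cy.
split=> //.
- rewrite (card_fibers c) -sumn_group_type_sizes -(perm_sumn sizes).
  by rewrite sumnE big_map big_enum.
- apply/and3P; split.
  + apply/eqP/setP => x; rewrite inE; apply/bigcupP.
    by exists (fiber c (c x)); [apply: imset_f | rewrite inE].
  + apply/trivIsetP => _ _ /imsetP[a _ ->] /imsetP[a' _ ->] neq.
    rewrite -setI_eq0; apply/eqP/setP => x; rewrite !inE.
    by apply/negP => /andP[/eqP-> /eqP eq_aa']; rewrite eq_aa' eqxx in neq.
  + apply/imsetP => -[a _ /setP fa0]; have [x cx] := c_surj a.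
    by have := fa0 x; rewrite !inE cx eqxx.
- apply: (perm_trans _ sizes).
  rewrite [X in perm_eq _ X](map_comp (fun g : {set X} => #|g|) (fiber c)).
  apply: perm_map; apply: uniq_perm.
  + exact: enum_uniq.
  + by rewrite map_inj_uniq ?enum_uniq.
  + move=> g; rewrite mem_enum; apply/imsetP/mapP => -[a _ ->];
      by exists a; rewrite ?mem_enum.
- by move=> b /Bblock[].
- by move=> b /Bblock[_ injb]; apply/transverseP.
- move=> T cardT /transverseP injT; have [p [pB p_uniq]] := Bext T cardT injT.
  exists (p |: T); split=> [|b [bB sTb]]; first by split=> //; apply: subsetUr.
  have [cardb _] := Bblock b bB.
  have /eqP/cards1P[q bT] : #|b :\: T| = 1.
    by rewrite cardsD (setIidPr sTb) cardb cardT subSnn.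
  have b_eq : b = q |: T by rewrite -bT -{2}(setIidPr sTb) setUC setID.
  by rewrite b_eq (p_uniq q) // -b_eq.
Qed.

(** * Giving weight to the points *)

(** When the members of [B] have [t + 1] points, the condition on the cardinality
    makes the projection injective on [b]. *)
Definition inflate (X : finType) (M : finZmodType) (t : nat)
    (B : {set {set X}}) : {set {set X * M}} :=
  [set b : {set X * M} |
    [&& #|b| == t.+1, fst @: b \in B & (\sum_(p in b) p.2 == 0)%R]].

(** The base design determines the projection of the new point, and the vanishing
    of the sum of labels then determines its label. *)
Lemma inflate_extendable (t : nat) (X I : finType) (M : finZmodType)
    (c : X -> I) (B : {set {set X}}) :
  one_point_extendable t c B ->
  one_point_extendable t (fun p : X * M => c p.1) (inflate M t B).
Proof.
move=> [Bblock Bext]; split=> [b | T cardT injT].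
  rewrite inE => /and3P[/eqP cardb fstb _]; split=> //.
  have [card_fst inj_fst] := Bblock _ fstb.
  have fst_inj : {in b &, injective fst}.
    by apply/imset_injP; rewrite card_fst cardb.
  move=> p q pb qb cpq; apply: fst_inj => //.
  by apply: inj_fst => //; apply: imset_f.
have fst_inj : {in T &, injective fst}.
  by move=> p q pT qT eq_pq; apply: injT => //; rewrite eq_pq.
have card_fst : #|fst @: T| = t by rewrite card_in_imset.
have inj_fst : {in fst @: T &, injective c}.
  move=> _ _ /imsetP[p pT ->] /imsetP[q qT ->] cpq.
  by congr (_.1); apply: injT.
have [y [yB y_uniq]] := Bext _ card_fst inj_fst.
have extE x u : (x, u) |: T \in inflate M t B <->
    x |: fst @: T \in B /\ u = (- \sum_(p in T) p.2)%R.
  rewrite inE imsetU1 /=; split=> [/and3P[cardb xB sum0] | [xB ->]].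
    split=> //; have xuT : (x, u) \notin T.
      by move: cardb; rewrite cardsU1 cardT; case: (_ \in T); rewrite // ltn_eqF.
    by move: sum0; rewrite big_setU1 //= addr_eq0 => /eqP.
  have xT : x \notin fst @: T.
    have [/eqP] := Bblock _ xB.
    by rewrite cardsU1 card_fst; case: (_ \in _); rewrite // ltn_eqF.
  have xuT v : (x, v) \notin T by apply: contra xT => /(imset_f fst).
  by rewrite cardsU1 cardT xuT xB big_setU1 //= addNr !eqxx.
exists (y, - \sum_(p in T) p.2)%R; split=> [|[x u]]; first by apply/extE.
by move=> /extE[/y_uniq-> ->].
Qed.

Lemma card_fiber_fst (X I M : finType) (c : X -> I) a :
  #|fiber (fun p : X * M => c p.1) a| = #|fiber c a| * #|M|.
Proof.
rewrite -cardsT -cardsX; congr #|pred_of_set _|.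
by apply/setP => -[x u]; rewrite !inE andbT.
Qed.

(** * Even graphs on five vertices *)

(** [next s] fixes the vertices that are not on the cycle [s], hence the condition
    [i != j]. *)
Definition on_cycle (s : seq nat) (i j : nat) : bool :=
  (i != j) && ((next s i == j) || (next s j == i)).

(** Two of the three 4-cycles on the vertices other than [k] span the third one. *)
Definition small_graph (k : nat) (x : bool * bool) (i j : nat) : bool :=
  let cycle s := on_cycle [seq (k + d) %% 5 | d <- s] i j in
  (x.1 && cycle [:: 1; 2; 3; 4]) (+) (x.2 && cycle [:: 1; 2; 4; 3]).

Definition large_graph (z : bool * bool * bool) (i j : nat) : bool :=
  (z.1.1 && on_cycle [:: 0; 1; 2; 3; 4] i j) (+)
  (z.1.2 && on_cycle [:: 0; 1; 3; 4; 2] i j) (+)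
  (z.2 && on_cycle [:: 0; 1; 4; 2; 3] i j).

(** A point carries the coefficients of its graph on the chosen spanning cycles. *)
Definition point : finType := ('I_5 * (bool * bool) + bool * bool * bool)%type.

Definition class (p : point) : option 'I_5 :=
  if p is inl kx then Some kx.1 else None.

Definition edge (p : point) : nat -> nat -> bool :=
  match p with
  | inl kx => small_graph kx.1 kx.2
  | inr z => large_graph z
  end.

Definition beats (i j : nat) : bool := ((j + 5 - i) %% 5) \in [:: 1; 2].

(** * Stars of the graphs of a group *)

Fixpoint bitseqs (n : nat) : seq bitseq :=
  if n is m.+1 then [seq b :: s | b <- [:: true; false], s <- bitseqs m]
  else [:: [::]].

Lemma mem_bitseqs s : s \in bitseqs (size s).
Proof.
elim: s => //= b s IH.
by rewrite cats0 mem_cat; case: b; rewrite map_f ?orbT.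
Qed.

Lemma exists_unique_count (T : eqType) (P : pred T) (s : seq T) :
  (forall x, x \in s) -> count P s == 1 -> exists! x, P x.
Proof.
move=> s_full; rewrite -size_filter => /eqP sz1.
have mem_s y : P y -> y \in filter P s by rewrite mem_filter s_full andbT.
case def_s : (filter P s) sz1 mem_s => [|x []] // _ mem_s.
exists x; split=> [|y /mem_s]; last by rewrite inE => /eqP.
have : x \in filter P s by rewrite def_s inE eqxx.
by rewrite mem_filter => /andP[].
Qed.

Definition bools := [:: true; false].
Definition bool_pairs := [seq (a, b) | a <- bools, b <- bools].
Definition bool_triples := [seq (ab, c) | ab <- bool_pairs, c <- bools].
Definition star (g : nat -> nat -> bool) (i : nat) : bitseq := mkseq (g i) 5.

(** Quantifying over bit sequences lets the existence and uniqueness of a graph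
    with a given star at [i] be decided by computation; [isolated] is the set of
    vertices that no such star can contain. *)
Definition star_check (T : Type) (g : T -> nat -> nat -> bool) (s : seq T)
    (i : nat) (isolated : pred nat) : bool :=
  all (fun d =>
    (~~ foldr addb false d &&
     all (fun k => isolated k ==> ~~ nth false d k) (iota 0 5))
    ==> (count (fun x => star (g x) i == d) s == 1)) (bitseqs 5).

Lemma small_star_check :
  all (fun k => all (fun i => (i == k) ||
    star_check (small_graph k) bool_pairs i (pred2 i k))
    (iota 0 5)) (iota 0 5).
Proof. by vm_compute. Qed.

Lemma large_star_check :
  all (fun i => star_check large_graph bool_triples i (pred1 i)) (iota 0 5).
Proof. by vm_compute. Qed.

Lemma mkseq5P (f g : nat -> bool) :
  (forall j : 'I_5, f j = g j) <-> mkseq f 5 = mkseq g 5.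
Proof.
split=> [eq_fg | eq_fg j]; last first.
  by rewrite -(nth_mkseq false f (ltn_ord j)) eq_fg nth_mkseq.
apply: (@eq_from_nth _ false) => [|j]; rewrite !size_mkseq // => lt_j.
by rewrite !nth_mkseq // (eq_fg (Ordinal lt_j)).
Qed.

Lemma star_checkP (T : eqType) (g : T -> nat -> nat -> bool) s (i : 'I_5)
    (isolated : pred nat) (d : nat -> bool) :
  (forall x, x \in s) -> star_check g s i isolated ->
  \big[addb/false]_(j < 5) d j = false ->
  (forall k : 'I_5, isolated k -> d k = false) ->
  exists! x, forall j : 'I_5, g x i j = d j.
Proof.
move=> s_full /allP/(_ _ (mem_bitseqs (mkseq d 5))) check even_d iso_d.
have {check} : count (fun x => star (g x) i == mkseq d 5) s == 1.
  move: check => /implyP; apply; apply/andP; split.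
    by move: even_d; rewrite !big_ord_recl big_ord0 /= => ->.
  apply/allP => k; rewrite mem_iota => lt_k; apply/implyP => iso_k.
  by rewrite nth_mkseq // (iso_d (Ordinal lt_k)).
move=> /(exists_unique_count s_full)[x [/eqP/mkseq5P x_d x_uniq]].
by exists x; split=> // y y_d; apply: x_uniq; apply/eqP/mkseq5P.
Qed.

(** Each group has as many graphs as there are compatible even stars at [i], and
    they are separated by their stars at [i] because no nonempty one of them has
    an isolated vertex, apart from [k] in group [k].  The spanning cycles are
    chosen for this property. *)
Lemma exists_unique_star (i : 'I_5) (a : option 'I_5) (d : nat -> bool) :
  a != Some i -> \big[addb/false]_(j < 5) d j = false -> d i = false ->
  (forall k, a = Some k -> d k = false) ->
  exists! p, class p = a /\ forall j : 'I_5, edge p i j = d j.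
Proof.
move=> a_neq even_d d_i d_a.
have iP (j : 'I_5) : val j \in iota 0 5 by rewrite mem_iota /=.
case: a a_neq d_a => [k|] a_neq d_a.
  have [|||x [x_d x_uniq]] := @star_checkP _ (small_graph k)
    bool_pairs i (pred2 (val i) (val k)) d _ _ even_d.
  - by do 3!case.
  - have /allP/(_ _ (iP k))/allP/(_ _ (iP i)) := small_star_check.
    by case/orP=> // /eqP/val_inj eq_ik; rewrite eq_ik eqxx in a_neq.
  - by move=> j /orP[] /eqP/val_inj ->; [|apply: d_a].
  exists (inl (k, x)); split=> // -[[k' y]|z] [] //= [->] y_d.
  by rewrite (x_uniq y).
have [|||z [z_d z_uniq]] := @star_checkP _ large_graph
  bool_triples i (pred1 (val i)) d _ _ even_d.
- by do 5!case.
- exact: (allP large_star_check _ (iP i)).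
- by move=> j /eqP/val_inj ->.
exists (inr z); split=> // -[[k' y]|y] [] //= _ y_d.
by rewrite (z_uniq y).
Qed.

(** * Symmetry and parity of edges, and the tournament *)

Lemma on_cycle_sym s i j : on_cycle s i j = on_cycle s j i.
Proof. by rewrite /on_cycle eq_sym orbC. Qed.

Lemma edge_sym p i j : edge p i j = edge p j i.
Proof.
by case: p => [kx|z]; rewrite /= /small_graph /large_graph;
  rewrite !(on_cycle_sym _ i j).
Qed.

Lemma edge_irr p i : edge p i i = false.
Proof.
by case: p => [kx|z];
  rewrite /= /small_graph /large_graph /on_cycle eqxx /= !andbF.
Qed.

Lemma edge_class p (k j : 'I_5) : class p = Some k -> edge p k j = false.
Proof.
case: p => [[k' [a b]]|//] [->] /=.
suff /allP/(_ (val k)) : all (fun k => all (fun a => all (fun b => all (fun j =>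
  ~~ small_graph k (a, b) k j) (iota 0 5)) bools) bools) (iota 0 5).
  rewrite mem_iota => /(_ (ltn_ord k))/allP/(_ a) check.
  have {check}/allP/(_ b) check := check ltac:(by case: a {check}).
  have {check}/allP/(_ (val j)) := check ltac:(by case: b {check}).
  by rewrite mem_iota => /(_ (ltn_ord j))/negPf.
by vm_compute.
Qed.

(** Sums of cycles have even degrees. *)
Lemma edge_even p (i : 'I_5) : \big[addb/false]_(j < 5) edge p i j = false.
Proof.
rewrite !big_ord_recl big_ord0 /=.
by case: p => [[[[|[|[|[|[|//]]]]] ?] [[] []]]|[[[] []] []]];
   case: i => [[|[|[|[|[|//]]]]] ?].
Qed.

Lemma beats_irr i : beats i i = false.
Proof. by rewrite /beats addnC addnK. Qed.

Lemma beats_antisym (i j : 'I_5) : i != j -> beats j i = ~~ beats i j.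
Proof.
by rewrite -val_eqE; case: i j => [[|[|[|[|[|//]]]]] ?] [[|[|[|[|[|//]]]]] ?].
Qed.

Lemma beats_even (i : 'I_5) : \big[addb/false]_(j < 5) beats i j = false.
Proof.
by rewrite !big_ord_recl big_ord0 /=; case: i => [[|[|[|[|[|//]]]]] ?].
Qed.

(** * The design of type 4^5 8^1 *)

Definition graph_sum (b : {set point}) (i j : nat) : bool :=
  \big[addb/false]_(p in b) edge p i j.

(** A transverse 5-set meeting the large group, whose class is [None], misses
    exactly one class, so the last condition concerns a single vertex [i]. *)
Definition base_blocks : {set {set point}} :=
  [set b : {set point} | [&& #|b| == 5, #|class @: b| == 5, None \in class @: b
    & [forall i, (Some i \notin class @: b) ==>
        [forall j : 'I_5, graph_sum b i j == beats i j]]]].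

Lemma graph_sum_sym T i j : graph_sum T i j = graph_sum T j i.
Proof. by apply: eq_bigr => p _; apply: edge_sym. Qed.

(** What the star of [i] in a fifth graph must be for [T] to become a block that
    misses group [i]. *)
Definition deficit (T : {set point}) (i j : nat) : bool :=
  graph_sum T i j (+) beats i j.

Lemma deficit_even T (i : 'I_5) :
  \big[addb/false]_(j < 5) deficit T i j = false.
Proof.
rewrite big_split /= beats_even addbF exchange_big big1 // => p _.
exact: edge_even.
Qed.

Lemma deficit_irr T i : deficit T i i = false.
Proof.
by rewrite /deficit beats_irr addbF /graph_sum big1 // => p; rewrite edge_irr.
Qed.

(** This decides from which of the two missing small groups a 4-set extends. *)
Lemma deficit_antisym T (i j : 'I_5) :
  i != j -> deficit T j i = ~~ deficit T i j.
Proof. by move=> neq; rewrite /deficit beats_antisym // graph_sum_sym addbN. Qed.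

(** If [T] misses the classes [a] and [Some i], adding a point of class [a] leaves
    only vertex [i] to be tested. *)
Lemma base_extendE (T : {set point}) a (i : 'I_5) p :
  #|T| = 4 -> {in T &, injective class} -> ~: (class @: T) = [set a; Some i] ->
  a != Some i -> class p = a ->
  p |: T \in base_blocks <->
  None \in a |: class @: T /\ forall j : 'I_5, edge p i j = deficit T i j.
Proof.
move=> cardT injT missing a_neq cp.
have a_new : a \notin class @: T by rewrite -in_setC missing !inE eqxx.
have p_new : p \notin T by apply: contra a_new => /(imset_f class); rewrite cp.
have only_i k : (Some k \notin a |: class @: T) = (k == i).
  rewrite in_setU1 negb_or -[_ \notin class @: T]in_setC missing !inE.
  case: eqVneq => [ka | _] //=; apply/esym/negP => /eqP eq_ki.
  by rewrite -ka eq_ki eqxx in a_neq.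
have sumE j :
    (graph_sum (p |: T) i j == beats i j) = (edge p i j == deficit T i j).
  rewrite /graph_sum big_setU1 //= /deficit /graph_sum.
  by case: (edge p i j) (\big[_/_]_(q in T) _) (beats i j) => [] [] [].
rewrite inE imsetU1 cp !cardsU1 p_new a_new cardT card_in_imset // cardT /=.
split=> [/andP[-> /forallP/(_ i)] | [-> p_ok]].
  by rewrite only_i eqxx => /forallP p_ok; split=> // j; apply/eqP; rewrite -sumE.
apply/forallP => k; rewrite only_i; apply/implyP => /eqP ->.
by apply/forallP => j; rewrite sumE p_ok.
Qed.

(** Among the two classes missed by [T], the class [a] of the fifth point has to be
    the large group if that one is missed, and is otherwise selected by the
    tournament. *)
Lemma base_extendable : one_point_extendable 4 class base_blocks.
Proof.
split=> [b | T cardT injT].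
  rewrite inE => /and4P[/eqP cardb /eqP card_cb _ _]; split=> //.
  by apply/imset_injP; rewrite card_cb cardb.
have card_missing : #|~: (class @: T)| = 2.
  have := cardsC (class @: T).
  by rewrite card_in_imset // cardT card_option card_ord => -[].
have [a [i [missing a_neq None_in d_a]]] : exists a i,
    [/\ ~: (class @: T) = [set a; Some i], a != Some i,
        None \in a |: class @: T
      & forall k, a = Some k -> deficit T i k = false].
  have /cards2P[a [b [neq missing]]] : #|~: (class @: T)| == 2.
    by rewrite card_missing.
  have in_missing c : (c \in class @: T) = ~~ ((c == a) || (c == b)).
    by rewrite -[LHS]negbK -in_setC missing !inE.
  case: a b neq missing in_missing => [k|] [i|] // neq missing in_missing.
  - case def_d : (deficit T i k).
      exists (Some i), k; split.
      + by rewrite setUC.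
      + by rewrite eq_sym.
      + by rewrite in_setU1 in_missing.
      + move=> _ [<-]; rewrite deficit_antisym ?def_d //.
        by apply: contra neq => /eqP ->.
    exists (Some k), i; split=> // [|_ [<-] //].
    by rewrite in_setU1 in_missing.
  - by exists None, k; split; rewrite // ?in_setU1 // setUC.
  - by exists None, i; split; rewrite // in_setU1.
have [p [[cp p_ok] p_uniq]] := exists_unique_star a_neq (deficit_even T i)
  (deficit_irr T i) d_a.
exists p; split=> [|q qB]; first by apply/(base_extendE cardT injT missing).
have : class q \in ~: (class @: T).
  move: qB; rewrite !inE imsetU1 => /and4P[_].
  by rewrite !cardsU1 card_in_imset // cardT; case: (_ \in class @: T).
rewrite missing !inE => /orP[/eqP cq | /eqP cq].
  apply: p_uniq; split=> //.
  by have /(base_extendE cardT injT missing a_neq cq)[] := qB.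
case: a => [k|] in missing a_neq None_in d_a cp p_uniq *; last first.
  have none_out : None \notin class @: T by rewrite -in_setC missing !inE eqxx.
  move: qB; rewrite inE imsetU1 cq => /and4P[_ _ + _].
  by rewrite in_setU1 (negPf none_out).
(* [q] lies in group [i], so its graph has no edge [ki], whereas the deficit
   at [k] contains [i]. *)
have neq_ik : i != k by apply: contra a_neq => /eqP ->.
have missing' : ~: (class @: T) = [set Some i; Some k] by rewrite setUC.
have /(base_extendE cardT injT missing' neq_ik cq)[_ /(_ i)] := qB.
by rewrite edge_sym (edge_class _ cq) deficit_antisym // d_a.
Qed.

(** * Group sizes and conclusion *)

Lemma card_fiber_class a : #|fiber class a| = if a is Some _ then 4 else 8.
Proof.
case: a => [k|].
  have -> : fiber class (Some k) = [set inl (k, x) | x : bool * bool].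
    apply/setP => -[[k' x]|z]; rewrite !inE.
      apply/eqP/imsetP => [[->] | [y _ [-> _]]] //; by exists x.
    by apply/esym/negP => /imsetP[].
  by rewrite card_imset ?card_prod ?card_bool // => x y [].
have -> : fiber class None = [set inr z | z : bool * bool * bool].
  apply/setP => -[[k' x]|z]; rewrite !inE; last by rewrite imset_f.
  by apply/esym/negP => /imsetP[].
by rewrite card_imset ?card_prod ?card_bool // => x y [].
Qed.

Theorem corollary8 (h : nat) (h_gt0 : 0 < h) :
  exists (X : finType) (G B : {set {set X}}),
    is_GDD 4 5 (5 * (4 * h) + 8 * h) [:: (4 * h, 5); (8 * h, 1)] G B.
Proof.
case: h h_gt0 => // n _.
pose c (p : point * 'I_n.+1) := class p.1.
exists (point * 'I_n.+1)%type, [set fiber c a | a : option 'I_5],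
  (inflate 'I_n.+1 4 base_blocks).
have <- : group_type_order [:: (4 * n.+1, 5); (8 * n.+1, 1)] =
    5 * (4 * n.+1) + 8 * n.+1.
  by rewrite /group_type_order !big_cons big_nil /= mul1n addn0.
apply: GDD_of_classes => //; last exact: inflate_extendable base_extendable.
  case=> [k|]; first by exists (inl (k, (true, true)), ord0).
  by exists (inr (true, true, true), ord0).
have sizeE a : #|fiber c a| = (if a is Some _ then 4 else 8) * n.+1.
  by rewrite card_fiber_fst card_fiber_class card_ord.
rewrite (eq_map sizeE) enumT unlock /= -map_comp -enumT.
have -> : [seq ((fun a : option 'I_5 => (if a is Some _ then 4 else 8) * n.+1)
             \o Some) i | i <- enum 'I_5] = nseq 5 (4 * n.+1).
  by rewrite -[5 in RHS]card_ord cardE; elim: (enum 'I_5) => //= k s ->.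
by rewrite -cat1s perm_catC.
Qed.
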